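(* Let $\mathcal X=\min\{\mathfrak g_{sr},\mathfrak g_{sd}\}$ and $\bar C_{s_1,\mathrm{MRC}}:=\tfrac12\mathbb E[\log_2(1+\rho\mathcal X)-\log_2(1+a_2\rho\mathcal X)]$. Then, with $\Phi=\frac{m_{sr}}{\Omega_{sr}}+\frac{m_{sd}}{\Omega_{sd}}$, $$\bar C_{s_1,\mathrm{MRC}}=\frac{1}{2\ln2}\sum_{\mu=0}^{m_{sr}N_r-1}\sum_{\nu=0}^{m_{sd}N_d-1}\frac{m_{sr}^{\mu}m_{sd}^{\nu}\,\Gamma(\mu+\nu+1)}{\Omega_{sr}^{\mu}\Omega_{sd}^{\nu}\,\mu!\,\nu!\,\rho^{\mu+\nu}}\Big\{e^{\Phi/\rho}\,\Gamma\Big[-\mu-\nu,\tfrac{\Phi}{\rho}\Big]-\frac{1}{a_2^{\mu+\nu}}e^{\Phi/(\rho a_2)}\,\Gamma\Big[-\mu-\nu,\tfrac{\Phi}{\rho a_2}\Big]\Big\}.$$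
   Context: Let $N_r,N_d$ be positive integers, $m_{sr},m_{sd},m_{rd}$ positive integers, and $\Omega_{sr},\Omega_{sd},\Omega_{rd}>0$. Let $\{G_{sr,i}\}_{i=1}^{N_r}$, $\{G_{sd,j}\}_{j=1}^{N_d}$, $\{G_{rd,k}\}_{k=1}^{N_d}$ be mutually independent random variables, where each $G_{sr,i}$ has the Gamma density $f(x)=\frac{(m_{sr}/\Omega_{sr})^{m_{sr}}x^{m_{sr}-1}}{\Gamma(m_{sr})}e^{-m_{sr}x/\Omega_{sr}}$, $x>0$, and analogously $G_{sd,j}$ with parameters $(m_{sd},\Omega_{sd})$ and $G_{rd,k}$ with $(m_{rd},\Omega_{rd})$. Maximal-ratio combining (MRC) gains: $\mathfrak g_{sr}=\sum_{i=1}^{N_r}G_{sr,i}$, $\mathfrak g_{sd}=\sum_{j=1}^{N_d}G_{sd,j}$, $\mathfrak g_{rd}=\sum_{k=1}^{N_d}G_{rd,k}$. Let $\rho>0$ and $a_1,a_2\in(0,1)$ with $a_1+a_2=1$, $a_1>a_2$. $\Gamma[s,z]=\int_z^\infty t^{s-1}e^{-t}\,dt$ ($z>0$) is the upper incomplete Gamma function. *)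

(* Defs.v *)
From HB Require Import structures.
From mathcomp Require Import all_boot all_order all_algebra.
From mathcomp Require Import all_classical all_reals all_analysis.
Set Implicit Arguments. Unset Strict Implicit. Unset Printing Implicit Defensive.
Import Order.TTheory GRing.Theory Num.Theory.
Local Open Scope classical_set_scope.
Local Open Scope ring_scope.

Definition mutually_independent {d : measure_display} {T : measurableType d}
  {R : realType} (P : probability T R) (I : finType) (X : I -> T -> R) : Prop :=
  forall (S : {set I}) (B : I -> set R),
    (forall i, measurable (B i)) ->
    P (\bigcap_(i in [set j | j \in S]) (X i @^-1` B i)) =
    (\prod_(i in S) P (X i @^-1` B i))%E.

(* Gamma(m, Omega) density, m a positive integer so Gamma(m) = (m-1)!;
   the density is 0 for x <= 0. *)
Definition gamma_pdf {R : realType} (m : nat) (Om : R) (x : R) : R :=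
  if 0 < x then
    (m%:R / Om) ^+ m * x ^+ m.-1 / (m.-1)`!%:R * expR (- (m%:R * x / Om))
  else 0.

Definition has_density {d : measure_display} {T : measurableType d}
  {R : realType} (P : probability T R) (X : T -> R) (f : R -> R) : Prop :=
  measurable_fun setT X /\
  forall A : set R, measurable A ->
    P (X @^-1` A) = (\int[@lebesgue_measure R]_(x in A) (f x)%:E)%E.

Definition upper_inc_gamma {R : realType} (s z : R) : R :=
  Rintegral (@lebesgue_measure R) `[z, +oo[%classic
    (fun t => t `^ (s - 1) * expR (- t)).

Definition log2 {R : realType} (x : R) : R := ln x / ln 2.

(* Main.v *)
(** Write [l1 = msr / Osr] and [l2 = msd / Osd].  A Gamma variable of integer
    shape [m] is an Erlang variable, and the beta integral shows that Erlang
    densities of equal rate are closed under convolution; hence the two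
    combined gains are independent Erlang variables of shapes [msr * Nr] and
    [msd * Nd].  The tail of their minimum [X] is the product of the two tails,
    [exp(-(l1 + l2) x) * \sum_i \sum_j (l1 x)^i (l2 x)^j / (i! j!)].  By Tonelli,
    [E[ln(1 + r X)]] is the integral over [x > 0] of [r / (1 + r x)] times this
    tail, which reduces to the integrals of [x^n exp(-c x) r / (1 + r x)].
    These satisfy the same recurrence in [n] as
    [n! r^(-n) exp(c / r) Gamma[-n, c / r]], and the two agree for [n = 0].
    The theorem is the difference of the cases [r = rho] and [r = a2 rho]; on
    the null event [X <= 0] the integrand is irrelevant. *)
Require Import Defs.
From HB Require Import structures.
From mathcomp Require Import all_boot all_order all_algebra.
From mathcomp Require Import all_classical all_reals all_analysis.
From mathcomp Require Import measurable_realfun ring.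
Import Order.TTheory GRing.Theory Num.Theory.
Import numFieldNormedType.Exports.
Local Open Scope classical_set_scope.
Local Open Scope ring_scope.

(** * Integration by antiderivatives on segments and half-lines *)

Section calculus.
Context {R : realType}.
Local Notation mu := (@lebesgue_measure R).
Implicit Types (l w x y z : R) (f F : R -> R).

Lemma derivable1_continuous f x : derivable f x 1 -> {for x, continuous f}.
Proof. by move/derivable1_diffP; exact: differentiable_continuous. Qed.

Lemma continuous_is_derive f x y : is_derive x 1 f y -> {for x, continuous f}.
Proof. by case=> + _; exact: derivable1_continuous. Qed.

Lemma within_continuous f (A : set R) :
  (forall x, A x -> {for x, continuous f}) -> {within A, continuous f}.
Proof.
by move=> cf; apply: continuous_in_subspaceT => x; rewrite inE => /cf.
Qed.

(** The power is taken pointwise instead of in the ring of functions, so that instance resolution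
    can differentiate explicit lambda terms. *)
Global Instance is_derive_exprn f n x y : is_derive x 1 f y ->
  is_derive x 1 (fun z => f z ^+ n) (n%:R * f x ^+ n.-1 * y).
Proof.
move=> df; have := is_deriveX n df; rewrite (_ : f ^+ n = fun y => f y ^+ n).
  by move=> ?; exact: is_derive_eq.
by apply/funext => z; elim: n => [|n IH]; rewrite ?expr0// !exprS -IH.
Qed.

(** Two-sided derivability at [a] itself supplies the one-sided continuity of [F] that the
    fundamental theorem of calculus asks for at the endpoint. *)
Lemma ge0_integral_antiderivativey f F (a l : R) :
  (forall x, a <= x -> 0 <= f x) ->
  (forall x, a <= x -> {for x, continuous f}) ->
  (forall x, a <= x -> is_derive x 1 F (f x)) ->
  F x @[x --> +oo] --> l ->
  (\int[mu]_(x in `[a, +oo[) (f x)%:E = (l - F a)%:E)%E.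
Proof.
move=> f0 cf dF Fl; rewrite EFinB.
apply: ge0_continuous_FTC2y => //.
- by apply: within_continuous => x /=; rewrite in_itv/= andbT; exact: cf.
- by move=> x /ltW ax; have := dF x ax; case.
- apply: cvg_at_right_filter; exact: continuous_is_derive (dF a (lexx _)).
- move=> x; rewrite in_itv/= andbT => /ltW ax.
  by rewrite derive1E; apply: derive_val; exact: dF.
Qed.

Lemma integral_antiderivative f F (a b : R) : a < b ->
  (forall x, a <= x <= b -> {for x, continuous f}) ->
  (forall x, a <= x <= b -> is_derive x 1 F (f x)) ->
  (\int[mu]_(x in `[a, b]) (f x)%:E = (F b - F a)%:E)%E.
Proof.
move=> ab cf dF; rewrite EFinB; apply: continuous_FTC2 => //.
- by apply: within_continuous => x /=; rewrite in_itv/=; exact: cf.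
- split.
  + move=> x; rewrite in_itv/= => /andP[/ltW ax /ltW xb].
    by have := dF x; rewrite ax xb => /(_ isT); case.
  + apply: cvg_at_right_filter.
    by apply: continuous_is_derive (dF a _); rewrite lexx ltW.
  + apply: cvg_at_left_filter.
    by apply: continuous_is_derive (dF b _); rewrite lexx ltW.
- move=> x; rewrite in_itv/= => /andP[/ltW ax /ltW xb].
  by rewrite derive1E; apply: derive_val; apply: dF; rewrite ax xb.
Qed.

Lemma integral_itvoy_cy f (a : R) : measurable_fun `]a, +oo[ f ->
  (\int[mu]_(x in `]a, +oo[) (f x)%:E = \int[mu]_(x in `[a, +oo[) (f x)%:E)%E.
Proof. by move=> mf; apply: integral_itv_obnd_cbnd; exact/measurable_EFinP. Qed.

(** * Erlang tails, the beta integral and Erlang densities *)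

Lemma cvgy_exprM_expRN l n : 0 < l -> (l * x) ^+ n * expR (- (l * x)) @[x --> +oo] --> (0 : R).
Proof.
move=> l0.
have H : y ^+ n * expR (- y) @[y --> +oo] --> (0 : R).
  (* The upper bound [(n+1)! / y] comes from [e^y >= 1 + y^(n+1) / (n+1)!]. *)
  apply: (@squeeze_cvgr _ _ _ R (fun=> 0) (fun y => n.+1`!%:R * y^-1)).
  - near=> y.
    have y0 : 0 < y by near: y; exact: nbhs_pinfty_gt.
    apply/andP; split; first by rewrite mulr_ge0 ?expR_ge0// exprn_ge0// ltW.
    rewrite expRN ler_pdivrMr ?expR_gt0// mulrAC ler_pdivlMr// -exprSr mulrC.
    rewrite -ler_pdivrMr ?ltr0n ?fact_gt0//.
    by apply: le_trans (expR_ge1Dxn n (ltW y0)); rewrite lerDr.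
  - exact: cvg_cst.
  - rewrite -(mulr0 (n.+1`!%:R)); apply: cvgM; first exact: cvg_cst.
    apply/gtr0_cvgV0; [exact: nbhs_pinfty_gt|exact: cvg_id].
apply: (@cvg_comp _ _ _ (fun x => l * x) (fun y => y ^+ n * expR (- y)) _ (pinfty_nbhs R)) => //.
exact: gt0_cvgMry.
Unshelve. all: end_near. Qed.

(* The probability that a sum of [n] independent exponentials of rate [l] exceeds [x]. *)
Definition erlang_tail l n x : R := expR (- (l * x)) * \sum_(k < n) (l * x) ^+ k / k`!%:R.

Lemma erlang_tail0 l n : erlang_tail l n.+1 0 = 1.
Proof.
rewrite /erlang_tail big_ord_recl/= big1.
  by rewrite mulr0 oppr0 expR0 expr0 fact0 divr1 addr0 mul1r.
by move=> i _; rewrite mulr0 expr0n/= mul0r.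
Qed.

(** The derivative telescopes: the term of degree [n.+1] in the sum contributes the next density and
    cancels the previous one. *)
Lemma is_derive_erlang_tail l n x :
  is_derive x 1 (fun x => - erlang_tail l n.+1 x)
    (l ^+ n.+1 * x ^+ n / n`!%:R * expR (- (l * x))).
Proof.
elim: n => [|n IH].
  rewrite [X in is_derive _ _ X](_ : _ = fun x => - expR (- (l * x))); last first.
    by apply/funext => y; rewrite /erlang_tail big_ord1 expr0 fact0 divr1 mulr1.
  by apply: is_derive_eq; rewrite /GRing.scale/= fact0 divr1; ring.
rewrite [X in is_derive _ _ X](_ : _ = (fun x => - erlang_tail l n.+1 x) \-
   (fun x => ((n.+1)`!%:R^-1 * (l * x) ^+ n.+1) * expR (- (l * x)))); last first.
  by apply/funext => y/=; rewrite /erlang_tail big_ord_recr/=; ring.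
apply: is_derive_eq; rewrite /GRing.scale/= factS natrM.
have f0 : n`!%:R != 0 :> R by rewrite pnatr_eq0 -lt0n fact_gt0.
rewrite !exprMn !exprS; field.
by rewrite f0 nat1r pnatr_eq0.
Qed.

Lemma cvgy_erlang_tail l n : 0 < l -> erlang_tail l n x @[x --> +oo] --> (0 : R).
Proof.
move=> l0; elim: n => [|n IH].
  rewrite [X in X @ _](_ : _ = cst 0); first exact: cvg_cst.
  by apply/funext => x; rewrite /erlang_tail big_ord0 mulr0.
rewrite [X in X @ _](_ : _ = (fun x => erlang_tail l n x +
   (n`!%:R^-1 * ((l * x) ^+ n * expR (- (l * x)))))); last first.
  by apply/funext => y/=; rewrite /erlang_tail big_ord_recr/=; ring.
rewrite -[0]addr0; apply: cvgD => //.
rewrite -[0](mulr0 n`!%:R^-1); apply: cvgM; [exact: cvg_cst|exact: cvgy_exprM_expRN].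
Qed.

Lemma continuous_erlang l n : continuous (fun x => l ^+ n.+1 * x ^+ n / n`!%:R * expR (- (l * x))).
Proof. by move=> x; apply: derivable1_continuous; exact: ex_derive. Qed.

Lemma measurable_erlang l n (D : set R) : measurable D ->
  measurable_fun D (fun x => l ^+ n.+1 * x ^+ n / n`!%:R * expR (- (l * x))).
Proof.
move=> mD; apply: measurable_funTS; apply: continuous_measurable_fun.
exact: continuous_erlang.
Qed.

Lemma integral_erlang_itv l n (a : R) : 0 < l -> 0 <= a ->
  (\int[mu]_(x in `[a, +oo[) (l ^+ n.+1 * x ^+ n / n`!%:R * expR (- (l * x)))%:E
   = (erlang_tail l n.+1 a)%:E)%E.
Proof.
move=> l0 a0; rewrite [RHS](_ : _ = (0 - - erlang_tail l n.+1 a)%:E); last by rewrite sub0r opprK.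
apply: (@ge0_integral_antiderivativey _ (fun x => - erlang_tail l n.+1 x)).
- move=> x ax; have x0 := le_trans a0 ax.
  by rewrite mulr_ge0 ?expR_ge0// divr_ge0// mulr_ge0// exprn_ge0// ltW.
- move=> x _; exact: continuous_erlang.
- move=> x _; exact: is_derive_erlang_tail.
- rewrite -oppr0; apply: cvgN; exact: cvgy_erlang_tail.
Qed.

(* The derivative of the sum telescopes: each term cancels half of the next. *)
Lemma is_derive_beta_sum w n a y : (a < n)%N ->
  is_derive y 1 (fun y => \sum_(j < a.+1) (y ^+ j / j`!%:R) * ((w - y) ^+ (n - j) / (n - j)`!%:R))
   (- ((y ^+ a / a`!%:R) * ((w - y) ^+ (n.-1 - a) / (n.-1 - a)`!%:R))).
Proof.
case: n => // n; elim: a => [_|a IH an].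
  rewrite [X in is_derive _ _ X](_ : _ = fun y => (w - y) ^+ n.+1 * (n.+1)`!%:R^-1); last first.
    by apply/funext => z; rewrite big_ord1 subn0 expr0 fact0 divr1 mul1r.
  apply: is_derive_eq; rewrite /GRing.scale/= subn0 factS natrM fact0 expr0 divr1.
  have f0 : n`!%:R != 0 :> R by rewrite pnatr_eq0 -lt0n fact_gt0.
  by field; rewrite f0 nat1r pnatr_eq0.
have {}IH := IH (ltnW an).
set S := (fun y => \sum_(j < a.+1) _) in IH.
rewrite [X in is_derive _ _ X](_ : _ = S \+
  (fun y => (a.+1`!%:R^-1 * (n.+1 - a.+1)`!%:R^-1) *
     (y ^+ a.+1 * (w - y) ^+ (n.+1 - a.+1)))); last first.
  by apply/funext => z; rewrite /S/= [LHS]big_ord_recr/=; ring.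
rewrite ltnS in an; rewrite subSS /= in IH *.
have E : (n - a = (n - a.+1).+1)%N by rewrite -subSn.
rewrite E in IH *; set k := (n - a.+1)%N in IH *.
apply: is_derive_eq; rewrite /GRing.scale/= !factS !natrM.
have f0 m : m`!%:R != 0 :> R by rewrite pnatr_eq0 -lt0n fact_gt0.
have n0 m : m.+1%:R != 0 :> R by rewrite pnatr_eq0.
by field; rewrite !f0 !nat1r !n0.
Qed.

(** Dividing by the factorials normalises Euler's beta integral, so that its value is a single
    monomial. The antiderivative is the sum of [is_derive_beta_sum] at total degree [m + n + 1]. *)
Lemma integral_beta w m n : 0 < w ->
  (\int[mu]_(y in `[0%R, w]) (y ^+ m / m`!%:R * ((w - y) ^+ n / n`!%:R))%:E =
   (w ^+ (m + n).+1 / (m + n).+1`!%:R)%:E)%E.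
Proof.
move=> w0; pose N := (m + n).+1.
have mN : (m < N)%N by rewrite /N ltnS leq_addr.
pose S y := - \sum_(j < m.+1) (y ^+ j / j`!%:R) * ((w - y) ^+ (N - j) / (N - j)`!%:R).
have nE : (N.-1 - m = n)%N by rewrite /N/= addKn.
have dS y : is_derive y 1 S (y ^+ m / m`!%:R * ((w - y) ^+ n / n`!%:R)).
  rewrite /S; have dB := is_derive_beta_sum w _ _ y mN.
  by apply: is_derive_eq; rewrite nE opprK.
(* At [y = w] every exponent [N - j] is positive and all terms vanish; at [y = 0] only the term
   [j = 0] survives. *)
have Sw : S w = 0.
  rewrite /S big1 ?oppr0// => j _; rewrite subrr expr0n.
  by rewrite subn_eq0 leqNgt (leq_trans (ltn_ord j) mN) mul0r mulr0.
have S0 : S 0 = - (w ^+ N / N`!%:R).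
  rewrite /S big_ord_recl /= big1 ?addr0; last first.
    by move=> j _; rewrite expr0n/= mul0r mul0r.
  by rewrite expr0 fact0 divr1 mul1r !subr0 subn0.
have := @integral_antiderivative (fun y => y ^+ m / m`!%:R * ((w - y) ^+ n / n`!%:R)) S 0 w w0.
rewrite Sw S0 sub0r opprK; apply => // x _.
by apply: derivable1_continuous; exact: ex_derive.
Qed.

(* Density for shape [n.+1], so that [n = 0] is the exponential density. *)
Definition erlang_pdf l n x : R :=
  if 0 < x then l ^+ n.+1 * x ^+ n / n`!%:R * expR (- (l * x)) else 0.

Lemma erlang_pdf_ge0 l n x : 0 < l -> 0 <= erlang_pdf l n x.
Proof.
move=> l0; rewrite /erlang_pdf; case: ifP => // x0.
by rewrite mulr_ge0 ?expR_ge0// divr_ge0// mulr_ge0// exprn_ge0// ltW.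
Qed.

Lemma measurable_erlang_pdf l n : measurable_fun [set: R] (erlang_pdf l n).
Proof.
apply: measurable_fun_ifT => //; first exact: measurable_fun_ltr.
exact: measurable_erlang.
Qed.

Lemma integral_erlang_pdf_itv l n x : 0 < l -> 0 <= x ->
  (\int[mu]_(y in `]x, +oo[) (erlang_pdf l n y)%:E = (erlang_tail l n.+1 x)%:E)%E.
Proof.
move=> l0 x0; rewrite -integral_erlang_itv// -integral_itvoy_cy; last first.
  exact: measurable_erlang.
apply: eq_integral => y; rewrite inE/= in_itv/= andbT => xy.
by rewrite /erlang_pdf (le_lt_trans x0 xy).
Qed.

(** The integrand lives on [0 < u < w], where the two exponentials multiply to [expR (- (l * w))],
    free of [u]; what is left is the beta integral. *)
Lemma erlang_pdf_convolution l m n w :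
  (\int[mu]_u (erlang_pdf l m u * erlang_pdf l n (w - u))%:E =
   (erlang_pdf l (m + n).+1 w)%:E)%E.
Proof.
have [w0|w0] := leP w 0.
  rewrite /erlang_pdf (le_gtF w0) integral0_eq// => u _.
  case: ifP => u0; last by rewrite mul0r.
  by rewrite subr_gt0 (le_gtF (le_trans w0 (ltW u0))) mulr0.
pose c := l ^+ (m + n).+2 * expR (- (l * w)).
pose g u := u ^+ m / m`!%:R * ((w - u) ^+ n / n`!%:R).
have cg : continuous g.
  by move=> u; apply: derivable1_continuous; exact: ex_derive.
transitivity (\int[mu]_(u in `]0%R, w[) (c * g u)%:E)%E.
  rewrite [RHS]integral_mkcond; apply: eq_integral => u _; rewrite patchE.
  rewrite mem_setE in_itv/= /erlang_pdf subr_gt0.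
  case: ifPn => u0; last by rewrite mul0r.
  case: ifPn => uw; last by rewrite mulr0.
  congr EFin; rewrite /c /g; have -> : - (l * w) = - (l * u) + - (l * (w - u)) by ring.
  by rewrite expRD -addnS -addSn exprD; ring.
rewrite -(@integral_itv_bndoo _ _ _ _ true false); last first.
  apply/measurable_EFinP/measurable_funTS/measurable_funM => //.
  exact: continuous_measurable_fun.
under eq_integral do rewrite EFinM.
rewrite integralZl//; last first.
  apply: continuous_compact_integrable; first exact: segment_compact.
  exact: continuous_subspaceT.
rewrite integral_beta// -EFinM /erlang_pdf w0 /c; congr EFin; ring.
Qed.

End calculus.

(** * The upper incomplete Gamma function at nonpositive integers *)

Section incomplete_gamma.
Context {R : realType}.
Local Notation mu := (@lebesgue_measure R).
Implicit Types (z t x r c : R).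

(** The integrand of [upper_inc_gamma (- n%:R)], with the real power rewritten as the inverse of a
    natural power. *)
Let u n t : R := t ^- n.+1 * expR (- t).

Let u_ge0 n t : 0 < t -> 0 <= u n t.
Proof. by move=> t0; rewrite mulr_ge0 ?expR_ge0// invr_ge0 exprn_ge0// ltW. Qed.

Let is_derive_u n t : 0 < t -> is_derive t 1 (fun s => - u n s) (n.+1%:R * u n.+1 t + u n t).
Proof.
move=> t0; have tn0 : t ^+ n.+1 != 0 by rewrite expf_neq0// gt_eqF.
apply: is_derive_eq; rewrite /GRing.scale/= /u !exprS; field.
by rewrite expf_neq0 gt_eqF.
Qed.

Let continuous_u n t : 0 < t -> {for t, continuous (u n)}.
Proof.
move=> t0; have tn0 : t ^+ n.+1 != 0 by rewrite expf_neq0// gt_eqF.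
by apply: derivable1_continuous; exact: ex_derive.
Qed.

Let measurable_u n z : 0 < z -> measurable_fun `[z, +oo[ (u n).
Proof.
move=> z0; apply: subspace_continuous_measurable_fun => //.
apply: within_continuous => t; rewrite /= in_itv/= andbT => zt.
exact: continuous_u (lt_le_trans z0 zt).
Qed.

Let cvgy_u n : u n t @[t --> +oo] --> (0 : R).
Proof.
apply: (@squeeze_cvgr _ _ _ R (fun=> 0) (fun t => expR (- t))).
- near=> t; have t1 : 1 < t by near: t; exact: nbhs_pinfty_gt.
  rewrite u_ge0 ?(lt_trans ltr01)//= ler_piMl ?expR_ge0// invf_le1.
    by rewrite exprn_ege1// ltW.
  by rewrite exprn_gt0// (lt_trans ltr01).
- exact: cvg_cst.
- exact: cvgr_expR.
Unshelve. all: end_near. Qed.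

Let integral_u_ge0 n z : 0 < z -> (0 <= \int[mu]_(t in `[z, +oo[) (u n t)%:E)%E.
Proof.
move=> z0; apply: integral_ge0 => t; rewrite /= in_itv/= andbT => zt.
by rewrite lee_fin u_ge0// (lt_le_trans z0 zt).
Qed.

(** Integration by parts, obtained by integrating the derivative of [- u n]. As a sum of nonnegative
    terms it makes sense before the integrals are known to be finite. *)
Let integral_u_rec n z : 0 < z ->
  (n.+1%:R%:E * \int[mu]_(t in `[z, +oo[) (u n.+1 t)%:E
   + \int[mu]_(t in `[z, +oo[) (u n t)%:E = (u n z)%:E)%E.
Proof.
move=> z0.
have pos t : `[z, +oo[%classic t -> 0 < t.
  by rewrite /= in_itv/= andbT => /(lt_le_trans z0).
have I : (\int[mu]_(t in `[z, +oo[) (n.+1%:R * u n.+1 t + u n t)%:E = (u n z)%:E)%E.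
  rewrite -[u n z]opprK -sub0r.
  apply: (@ge0_integral_antiderivativey _ (fun t => n.+1%:R * u n.+1 t + u n t) (fun t => - u n t)).
  - move=> t zt; have t0 := lt_le_trans z0 zt.
    by apply: addr_ge0; [apply: mulr_ge0 => //|]; exact: u_ge0.
  - move=> t zt; have t0 := lt_le_trans z0 zt.
    apply: cvgD; last exact: continuous_u.
    by apply: cvgM; [exact: cvg_cst|exact: continuous_u].
  - by move=> t zt; exact: is_derive_u (lt_le_trans z0 zt).
  - by rewrite -oppr0; apply: cvgN; exact: cvgy_u.
rewrite -I -ge0_integralZl//.
- rewrite -ge0_integralD//.
  + by move=> t /pos t0; rewrite mule_ge0// lee_fin// u_ge0.
  + by apply/measurable_EFinP/measurable_funM => //; exact: measurable_u.
  + by move=> t /pos t0; rewrite lee_fin u_ge0.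
  + by apply/measurable_EFinP; exact: measurable_u.
- by apply/measurable_EFinP; exact: measurable_u.
- by move=> t /pos t0; rewrite lee_fin u_ge0.
Qed.

Lemma integral_upper_inc_gamma n z : 0 < z ->
  (\int[mu]_(t in `[z, +oo[) (t ^- n.+1 * expR (- t))%:E =
   (upper_inc_gamma (- n%:R) z)%:E)%E.
Proof.
move=> z0; rewrite /upper_inc_gamma /Rintegral.
rewrite (_ : (\int[mu]_(t in `[z, +oo[) (t `^ (- n%:R - 1) * expR (- t))%:E)%E =
  (\int[mu]_(t in `[z, +oo[) (u n t)%:E)%E).
  (* The recurrence bounds the integral by [u n z]; being finite, it is not altered by the [fine]
     inside [Rintegral]. *)
  rewrite fineK// ge0_fin_numE; last exact: integral_u_ge0.
  apply: le_lt_trans (ltry (u n z)); rewrite -integral_u_rec// leeDr//.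
  by rewrite mule_ge0// integral_u_ge0.
apply: eq_integral => t; rewrite inE/= in_itv/= andbT => zt.
rewrite -opprD natr1 powR_invn//; exact: ltW (lt_le_trans z0 zt).
Qed.

(** The recurrence [Gamma[s + 1, z] = s Gamma[s, z] + z^s e^(-z)] at [s = - (n + 1)]. *)
Lemma upper_inc_gamma_rec n z : 0 < z ->
  n.+1%:R * upper_inc_gamma (- n.+1%:R) z =
  z ^- n.+1 * expR (- z) - upper_inc_gamma (- n%:R) z.
Proof.
move=> z0; have := integral_u_rec n z z0.
rewrite /u !integral_upper_inc_gamma// -EFinM -EFinD => -[<-].
by rewrite addrK.
Qed.

(** The derivative of [ln (1 + r x)] against one term of a product of two Erlang tails; [c] will be
    the sum of the two rates. *)
Let k r c n x : R := x ^+ n * expR (- (c * x)) * (r / (1 + r * x)).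

Let k_den r x : 0 < r -> 0 <= x -> 1 + r * x != 0.
Proof. by move=> r0 x0; rewrite gt_eqF// ltr_pwDl// mulr_ge0// ltW. Qed.

Let k_ge0 r c n x : 0 < r -> 0 <= x -> 0 <= k r c n x.
Proof.
move=> r0 x0; rewrite mulr_ge0//; last first.
  by rewrite divr_ge0 ?ltW// ltr_pwDl// mulr_ge0// ltW.
by rewrite mulr_ge0 ?expR_ge0// exprn_ge0.
Qed.

Let continuous_k r c n x : 0 < r -> 0 <= x -> {for x, continuous (k r c n)}.
Proof.
move=> r0 x0; have d0 := k_den r x r0 x0.
by apply: derivable1_continuous; exact: ex_derive.
Qed.

Lemma measurable_exprM_expR_div r c n : 0 < r ->
  measurable_fun `[0 : R, +oo[%classic (fun x => x ^+ n * expR (- (c * x)) * (r / (1 + r * x))).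
Proof.
move=> r0; apply: subspace_continuous_measurable_fun => //.
by apply: within_continuous => t; rewrite /= in_itv/= andbT; exact: continuous_k.
Qed.

(* Substitution [t = c / r + c x]. *)
Let integral_k0 r c : 0 < r -> 0 < c ->
  (\int[mu]_(x in `[0%R, +oo[) (k r c 0 x)%:E =
   (expR (c / r) * upper_inc_gamma (- 0%:R) (c / r))%:E)%E.
Proof.
move=> r0 c0; have z0 : 0 < c / r by rewrite divr_gt0.
pose F x : R := c / r + c * x.
have dF x : is_derive x 1 F c.
  rewrite /F; move: (c / r) => z.
  by apply: is_derive_eq; rewrite /GRing.scale/= add0r mul1r mulr1.
have F'E : F^`()%classic = cst c.
  by apply/funext => x; rewrite derive1E; apply: derive_val.
have F0 : F 0 = c / r by rewrite /F mulr0 addr0.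
have := @increasing_ge0_integration_by_substitutiony R F (u 0) 0.
rewrite F'E F0 (integral_upper_inc_gamma 0)// EFinM => ->.
(* Since [t = c / r + c x = (c / r)(1 + r x)], the substituted integrand [c e^(-t) / t] equals
   [e^(- c / r)] times [k r c 0 x]. *)
- transitivity ((expR (c / r))%:E * \int[mu]_(x in `[0%R, +oo[)
      ((expR (- (c / r)))%:E * (k r c 0 x)%:E))%E; last first.
    congr (_ * _)%E; apply: eq_integral => x; rewrite inE/= in_itv/= andbT => x0.
    rewrite -EFinM /k /u /F !mulrfctE/= expr1 opprD expRD.
    have := k_den r x r0 x0 => ?.
    have -> : c / r + c * x = c / r * (1 + r * x) by field; rewrite gt_eqF.
    by congr EFin; field; apply/and3P; split; rewrite // gt_eqF.
  rewrite ge0_integralZl//.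
  + by rewrite muleA -EFinM -expRD subrr expR0 mul1e.
  + by apply/measurable_EFinP; exact: measurable_exprM_expR_div.
  + by move=> x; rewrite /= in_itv/= andbT => x0; rewrite lee_fin k_ge0.
- by move=> x y _ _ xy; rewrite /F ltrD2l ltr_pM2l.
- by move=> x _; exact: cst_continuous.
- exact: is_cvg_cst.
- exact: is_cvg_cst.
- split.
  + by move=> x _; have := dF x; case.
  + by apply: cvg_at_right_filter; exact: continuous_is_derive (dF 0).
- apply/cvgryPge => A; exists (c^-1 * (A - c / r)); split; first exact: num_real.
  by move=> x /ltW; rewrite /F ler_pdivrMl// lerBlDl.
- apply: within_continuous => t; rewrite /= in_itv/= andbT => zt.
  exact: continuous_u (lt_le_trans z0 zt).
- move=> t; rewrite in_itv/= andbT => zt.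
  exact: u_ge0 (lt_trans z0 zt).
Qed.

(* [r x / (1 + r x) + 1 / (1 + r x) = 1] *)
Let integral_k_rec r c n : 0 < r -> 0 < c ->
  (\int[mu]_(x in `[0%R, +oo[) (k r c n.+1 x)%:E +
   r^-1%:E * \int[mu]_(x in `[0%R, +oo[) (k r c n x)%:E =
   (n`!%:R / c ^+ n.+1)%:E)%E.
Proof.
move=> r0 c0; rewrite -ge0_integralZl//; last first.
- by rewrite lee_fin invr_ge0 ltW.
- by move=> x; rewrite /= in_itv/= andbT => x0; rewrite lee_fin k_ge0.
- by apply/measurable_EFinP; exact: measurable_exprM_expR_div.
rewrite -ge0_integralD//; last first.
- by apply/measurable_EFinP/measurable_funM => //; exact: measurable_exprM_expR_div.
- move=> x; rewrite /= in_itv/= andbT => x0.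
  by rewrite mule_ge0// lee_fin ?k_ge0// invr_ge0 ltW.
- by apply/measurable_EFinP; exact: measurable_exprM_expR_div.
- by move=> x; rewrite /= in_itv/= andbT => x0; rewrite lee_fin k_ge0.
have f0 : n`!%:R != 0 :> R by rewrite pnatr_eq0 -lt0n fact_gt0.
have cn0 : c ^+ n.+1 != 0 by rewrite expf_neq0// gt_eqF.
(* The two kernels add up to [x^n e^(- c x)], which is [n! / c^(n+1)] times an Erlang density, of
   total mass one. *)
transitivity (\int[mu]_(x in `[0%R, +oo[) ((n`!%:R / c ^+ n.+1)%:E *
    (c ^+ n.+1 * x ^+ n / n`!%:R * expR (- (c * x)))%:E))%E.
  apply: eq_integral => x; rewrite inE/= in_itv/= andbT => x0.
  have := k_den r x r0 x0 => d0.
  rewrite -EFinM -EFinD /k; congr EFin; rewrite (exprS x).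
  by field; rewrite f0 cn0 d0 gt_eqF.
rewrite ge0_integralZl//.
- by rewrite integral_erlang_itv// erlang_tail0 mule1.
- by apply/measurable_EFinP; exact: measurable_erlang.
- move=> x; rewrite /= in_itv/= andbT => x0; rewrite lee_fin.
  by rewrite mulr_ge0 ?expR_ge0// divr_ge0// mulr_ge0// exprn_ge0// ltW.
- by rewrite lee_fin divr_ge0// exprn_ge0// ltW.
Qed.

(** Multiplying [upper_inc_gamma_rec] at [z = c / r] by [n! r^-(n+1) e^z] turns its boundary term
    into [n! / c^(n+1)], which is the right-hand side of [integral_k_rec]. *)
Lemma integral_exprM_expR_div r c n : 0 < r -> 0 < c ->
  (\int[mu]_(x in `[0%R, +oo[) (x ^+ n * expR (- (c * x)) * (r / (1 + r * x)))%:E =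
   (n`!%:R / r ^+ n * expR (c / r) * upper_inc_gamma (- n%:R) (c / r))%:E)%E.
Proof.
move=> r0 c0; elim: n => [|n IH].
  by rewrite integral_k0// fact0 expr0 divr1 mul1r.
have := integral_k_rec r c n r0 c0; rewrite IH -EFinM.
set b := (X in (_ + X%:E)%E).
(* Subtraction in the extended reals is legitimate because the induction hypothesis makes this term
   a real number. *)
move=> /(congr1 (fun e => e - b%:E)%E); rewrite addeK// /k => ->.
rewrite -EFinB /b; congr EFin.
have z0 : 0 < c / r by rewrite divr_gt0.
rewrite factS natrM.
rewrite [RHS](_ : _ = n`!%:R / r ^+ n.+1 * expR (c / r) *
   (n.+1%:R * upper_inc_gamma (- n.+1%:R) (c / r))); last by ring.
rewrite upper_inc_gamma_rec// expRN.
have cn0 : c ^+ n != 0 by rewrite expf_neq0// gt_eqF.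
have rn0 : r ^+ n != 0 by rewrite expf_neq0// gt_eqF.
rewrite expr_div_n !exprS; field.
by rewrite cn0 rn0 !gt_eqF ?expR_gt0.
Qed.

End incomplete_gamma.

(** * Measures defined by a density *)

Lemma measurable_funT_restrict (d1 d2 : measure_display) (T1 : measurableType d1)
    (T2 : measurableType d2) (D : set T1) (f : T1 -> T2) :
  measurable D -> measurable_fun setT f -> measurable_fun setT (f \_ D).
Proof.
by move=> mD mf; apply: (measurable_restrictT _ mD).1; exact: measurable_funTS.
Qed.

Section density_measure.
Local Open Scope ereal_scope.
Context (d : measure_display) (T : measurableType d) (R : realType).
Variables (mu : {measure set T -> \bar R}) (f : T -> \bar R).

(** The two proofs are arguments so that the measure structure can be inferred from the term
    alone. *)
Definition density_measure of measurable_fun [set: T] f & (forall x, 0 <= f x) :=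
  fun A : set T => \int[mu]_(x in A) f x.

Variables (mf : measurable_fun [set: T] f) (f0 : forall x, 0 <= f x).
Local Notation nu := (density_measure mf f0).

Let nu0 : nu set0 = 0.
Proof. exact: integral_set0. Qed.

Let nu_ge0 A : 0 <= nu A.
Proof. exact: integral_ge0. Qed.

Let nu_sigma_additive : semi_sigma_additive nu.
Proof.
move=> /= F mF tF mUF; rewrite /density_measure; apply: cvg_toP.
  apply: ereal_nondecreasing_is_cvgn => m n mn.
  by apply: lee_sum_nneg_natr => // k _ _; exact: integral_ge0.
by rewrite ge0_integral_bigcup//=; exact: measurable_funTS.
Qed.

HB.instance Definition _ := isMeasure.Build _ _ _ nu nu0 nu_ge0 nu_sigma_additive.

End density_measure.

(** * Translation invariance of Lebesgue measure *)

Section translation.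
Context {R : realType}.
Local Notation mu := (@lebesgue_measure R).

Let lam : {measure set (measurableTypeR R) -> \bar R} := mu.

(** Lebesgue measure is determined by its values on the intervals []b, c]], whose length a
    translation preserves. *)
Lemma lebesgue_measure_translation (a : R) (A : set R) : measurable A ->
  pushforward mu (fun x : R => (x + a : measurableTypeR R)) A = mu A.
Proof.
move=> mA.
have ma : measurable_fun [set: R] (fun x : R => (x + a : measurableTypeR R)).
  exact: measurable_funD.
apply/esym/(@lebesgue_measure_unique _
  (pushforward mu (fun x : R => (x + a : measurableTypeR R)))) => //= _ [[b c]] _ <-.
rewrite /pushforward/=.
rewrite (_ : (fun x => x + a) @^-1` `]b, c]%classic = `](b - a), (c - a)]%classic); last first.
  by apply/seteqP; split => x /=; rewrite !in_itv/= ltrBlDr lerBrDr.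
rewrite !lebesgue_measure_itv/= !lte_fin ltrD2r.
by case: ifPn => // _; rewrite -!EFinB; congr EFin; ring.
Qed.

Lemma ge0_integral_translation (a : R) (f : R -> \bar R) :
  measurable_fun [set: R] f -> (forall x, 0 <= f x)%E ->
  (\int[mu]_x f (x + a)%R = \int[mu]_x f x)%E.
Proof.
move=> mf f0.
have ma : @measurable_fun _ _ (measurableTypeR R) (measurableTypeR R) setT (fun x => x + a).
  exact: measurable_funD.
rewrite -[LHS](@ge0_integral_pushforward _ _ _ _ _ _ ma lam setT f)//.
by apply: eq_measure_integral => //= A mA _; exact: lebesgue_measure_translation.
Qed.

End translation.

(** * Law of the sum of two variables independent on an event *)

Section independent_sum.
Context (d : measure_display) (T : measurableType d) (R : realType).
Variable P : probability T R.
Local Notation mu := (@lebesgue_measure R).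
Variables (E : set T) (mE : measurable E) (U V : T -> R).
Hypotheses (mU : measurable_fun setT U) (mV : measurable_fun setT V).
Variables (f g h : R -> R).
Hypotheses (mf : measurable_fun setT f) (mg : measurable_fun setT g).
Hypotheses (f0 : forall x, 0 <= f x) (g0 : forall x, 0 <= g x).
(** Given [E], the pair [(U, V)] has the product density. Carrying [E] along lets later inductions
    store in it the conditions on the variables outside the sum. *)
Hypothesis UV : forall A B, measurable A -> measurable B ->
  P (U @^-1` A `&` V @^-1` B `&` E) =
  (P E * (\int[mu]_(x in A) (f x)%:E * \int[mu]_(x in B) (g x)%:E))%E.

Let lam : {sigma_finite_measure set (measurableTypeR R) -> \bar R} := mu.
Local Notation RR := (measurableTypeR R * measurableTypeR R)%type.

Let p : R := fine (P E).
Let p0 : 0 <= p. Proof. exact: fine_ge0. Qed.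
Let pE : P E = p%:E. Proof. by rewrite fineK// fin_num_measure. Qed.

(** The density of the law of [(U, V)] on the event [E], hence of total mass [P E]. *)
Let q (z : RR) : \bar R := (p * (f z.1 * g z.2))%:E.
Let q0 z : (0 <= q z)%E. Proof. by rewrite lee_fin !mulr_ge0. Qed.
Let mq : measurable_fun setT q.
Proof.
apply/measurable_EFinP/measurable_funM => //; apply: measurable_funM.
  exact: measurableT_comp.
exact: measurableT_comp.
Qed.

Let W t : RR := (U t, V t).
Let mW : measurable_fun setT W.
Proof. exact/measurable_fun_pair. Qed.

(* Both sides are finite measures in [Z] that agree on rectangles. *)
Let joint_law (Z : set RR) : measurable Z ->
  P (W @^-1` Z `&` E) = (\int[lam \x lam]_(z in Z) q z)%E.
Proof.
(* The measurable rectangles: they generate the product sigma-algebra and are stable under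
   intersection. *)
pose C : set (set RR) :=
  [set C | exists A, measurable A /\ exists B, measurable B /\ C = A `*` B].
pose m1 : {measure set RR -> \bar R} := pushforward (mrestr P mE) W.
pose m2 : {measure set RR -> \bar R} := density_measure _ _ _ (lam \x lam)%E _ mq q0.
move=> mZ; rewrite -[LHS]/(m1 mW Z) -[RHS]/(m2 Z).
apply: (@measure_unique _ _ _ C (fun=> setT)) => //.
- rewrite measurable_prod_measurableType //; congr (<<s _ >>).
  rewrite predeqE; split => [[A mA [B mB <-]]|[A [mA [B [mB ->]]]]].
    by exists A; split => //; exists B.
  by exists A => //; exists B.
- move=> /= _ _ [X1 [mX1 [X2 [mX2 ->]]]] [Y1 [mY1 [Y2 [mY2 ->]]]].
  rewrite -setXI; exists (X1 `&` Y1); split; first exact: measurableI.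
  by exists (X2 `&` Y2); split => //; exact: measurableI.
- by move=> n; exists setT; split => //; exists setT; split => //; rewrite setXTT.
- by apply/seteqP; split => // x _; exists 0%N.
- move=> _ [A [mA [B [mB ->]]]].
  rewrite [LHS](UV _ _ mA mB) /m2/= /density_measure.
  (* Extension by zero turns the integral over the rectangle into one over the plane, which Tonelli
     factors. *)
  pose F := f \_ A; pose G := g \_ B.
  have mF : measurable_fun setT F by exact: measurable_funT_restrict.
  have mG : measurable_fun setT G by exact: measurable_funT_restrict.
  have F0 x : 0 <= F x by exact: restrict_ge0.
  have G0 x : 0 <= G x by exact: restrict_ge0.
  have FE : (\int[mu]_(x in A) (f x)%:E = \int[lam]_x (F x)%:E)%E.
    by rewrite integral_mkcond; apply: eq_integral => x _; rewrite /F !patchE; case: ifP.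
  have GE : (\int[mu]_(x in B) (g x)%:E = \int[lam]_x (G x)%:E)%E.
    by rewrite integral_mkcond; apply: eq_integral => x _; rewrite /G !patchE; case: ifP.
  rewrite FE GE integral_mkcond fubini_tonelli1.
  + rewrite /fubini_F.
    transitivity (\int[lam]_x ((p * F x)%:E * \int[lam]_y (G y)%:E))%E.
      rewrite ge0_integralZr//.
      * under [in RHS]eq_integral do rewrite EFinM.
        rewrite ge0_integralZl//; first by rewrite pE muleA.
          exact/measurable_EFinP.
        by move=> x _; rewrite lee_fin.
      * by apply/measurable_EFinP; exact: measurable_funM.
      * by move=> x _; rewrite lee_fin mulr_ge0.
      * by apply: integral_ge0 => x _; rewrite lee_fin.
    apply: eq_integral => x _; rewrite -ge0_integralZl//; last first.
    * by rewrite lee_fin mulr_ge0.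
    * by move=> y _; rewrite lee_fin.
    * exact/measurable_EFinP.
    apply: eq_integral => y _; rewrite -EFinM patchE /F /G !patchE in_setX/=.
    rewrite (_ : point = 0%:E :> \bar R)// (_ : point = 0 :> R)// /q/=.
    by case: (x \in A); case: (y \in B); rewrite /= ?mulrA// ?mulr0 ?mul0r.
  + by apply: measurable_funT_restrict => //; exact: measurableX.
  + by move=> x; apply: erestrict_ge0.
- move=> k; rewrite [X in (X < _)%E](_ : _ = P E); first by rewrite pE ltry.
  by rewrite /m1/= /pushforward /mrestr/= preimage_setT setTI.
Qed.

Hypotheses (mh : measurable_fun setT h) (h0 : forall x, 0 <= h x).
Hypothesis conv : forall w, (\int[mu]_u (f u * g (w - u))%:E = (h w)%:E)%E.

(** Integrate the joint density over the pairs with sum in [A]. For fixed [u], translating by [u]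
    replaces the second coordinate by the sum [w]; exchanging the integrals leaves the convolution
    [h w] inside. *)
Lemma independent_sum_law A : measurable A ->
  P ((U \+ V) @^-1` A `&` E) = (P E * \int[mu]_(x in A) (h x)%:E)%E.
Proof.
move=> mA.
pose Z : set RR := (fun z => z.1 + z.2) @^-1` A.
have mZ : measurable Z.
  by rewrite -[Z]setTI; apply: (measurable_funD measurable_fst measurable_snd).
rewrite -[LHS]/(P (W @^-1` Z `&` E)) joint_law//.
(* The integrand in the coordinates [(u, w)] with [w = u + v]. *)
pose psi (z : RR) := (\1_A z.2 * (p * (f z.1 * g (z.2 - z.1))))%:E.
have psi0 z : (0 <= psi z)%E by rewrite lee_fin !mulr_ge0.
have mpsi : measurable_fun setT psi.
  apply/measurable_EFinP/measurable_funM.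
    exact: (measurableT_comp (measurable_indic mA)).
  apply: measurable_funM => //; apply: measurable_funM; first exact: measurableT_comp.
  by apply: measurableT_comp => //; exact: measurable_funB.
rewrite integral_mkcond fubini_tonelli1; last 2 first.
- exact: measurable_funT_restrict.
- by move=> x; apply: erestrict_ge0.
transitivity (\int[lam]_u \int[lam]_w psi (u, w))%E.
  apply: eq_integral => u _.
  rewrite -(ge0_integral_translation u (fun w => psi (u, w)))//; last first.
    exact: measurableT_comp.
  apply: eq_integral => v _; rewrite patchE /psi /q /= addrK indicE.
  have -> : ((u, v) \in Z) = (v + u \in A) 
    by apply/idP/idP => /set_mem; rewrite /Z/= addrC => ?; exact/mem_set.
  by case: ifPn => _; rewrite ?mul1r ?mul0r.
rewrite fubini_tonelli//.
rewrite pE -ge0_integralZl//.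
- rewrite [RHS]integral_mkcond; apply: eq_integral => w _; rewrite patchE.
  rewrite /psi/= indicE; case: ifPn => wA; last first.
    by apply: integral0_eq => u _; rewrite mul0r.
  rewrite -conv -ge0_integralZl//.
  + by apply: eq_integral => u _; rewrite mul1r EFinM.
  + apply/measurable_EFinP/measurable_funM => //.
    by apply: measurableT_comp => //; exact: measurable_funB.
  + by move=> u _; rewrite lee_fin mulr_ge0.
- by apply/measurable_EFinP; exact: measurable_funTS.
- by move=> x _; rewrite lee_fin.
Qed.

End independent_sum.

(** * Sums of independent Erlang variables of equal rate *)

Section erlang_sum.
Context (d : measure_display) (T : measurableType d) (R : realType).
Variable P : probability T R.
Local Notation mu := (@lebesgue_measure R).

Lemma integral_erlang_pdf (l : R) n : 0 < l ->
  (\int[mu]_x (erlang_pdf l n x)%:E = 1)%E.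
Proof.
move=> l0; transitivity (\int[mu]_(x in `]0%R, +oo[) (erlang_pdf l n x)%:E)%E.
  rewrite [RHS]integral_mkcond; apply: eq_integral => x _; rewrite patchE.
  by rewrite mem_setE in_itv/= andbT /erlang_pdf; case: ifP.
by rewrite integral_erlang_pdf_itv// erlang_tail0.
Qed.

(** Induction on [n] for all [E] at once: the condition on the last variable is absorbed into [E],
    so the induction hypothesis yields the joint law of the partial sum and that variable, and
    [independent_sum_law] applies. The shape is [m.+1 * n.+1]; the predecessor appears because
    [erlang_pdf l k] has shape [k.+1]. *)
Lemma erlang_sum_law (l : R) m n (X : nat -> T -> R) (E : set T) :
  0 < l -> measurable E -> (forall i, measurable_fun setT (X i)) ->
  (forall B : nat -> set R, (forall i, measurable (B i)) ->
    P (\bigcap_(i in `I_n.+1) (X i @^-1` B i) `&` E) =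
    (P E * \prod_(i < n.+1) \int[mu]_(x in B i) (erlang_pdf l m x)%:E)%E) ->
  forall A, measurable A ->
    P ((fun t => \sum_(i < n.+1) X i t) @^-1` A `&` E) =
    (P E * \int[mu]_(x in A) (erlang_pdf l (m.+1 * n.+1).-1 x)%:E)%E.
Proof.
move=> l0 + mX; elim: n E => [|n IH] E mE HE A mA.
  have := HE (fun=> A) (fun=> mA); rewrite big_ord1 muln1/= => <-.
  congr (P (_ `&` _)); apply/seteqP; split => t /=.
    by rewrite big_ord1 => At i/=; rewrite ltnS leqn0 => /eqP ->.
  by move=> /(_ 0%N) /=; rewrite big_ord1; exact.
have bigcapS (B : nat -> set R) : \bigcap_(i in `I_n.+2) (X i @^-1` B i) =
    \bigcap_(i in `I_n.+1) (X i @^-1` B i) `&` X n.+1 @^-1` B n.+1.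
  apply/seteqP; split => t.
    by move=> H; split; [move=> i /= /leqW ni|]; apply: H => /=.
  move=> [H1 H2] i /=; rewrite ltnS leq_eqVlt => /predU1P[->//|]; exact: H1.
have mXn B : measurable B -> measurable (X n.+1 @^-1` B `&` E).
  by move=> mB; apply: measurableI => //; rewrite -[X in measurable X]setTI; exact: mX.
have PE B : measurable B -> P (X n.+1 @^-1` B `&` E) =
    (P E * \int[mu]_(x in B) (erlang_pdf l m x)%:E)%E.
  (* Leaving the first [n.+1] variables unconstrained, each integral being one, isolates the last
     variable. *)
  move=> mB; pose B' i := if (i < n.+1)%N then setT else B.
  have := HE B'; rewrite bigcapS big_ord_recr/= big1; last first.
    by move=> i _; rewrite /B' ltn_ord integral_erlang_pdf.
  rewrite /B' ltnn mul1e => <-; last by move=> i; case: ifP.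
  congr (P (_ `&` _)); apply/seteqP; split => t; last by case.
  by move=> ?; split => // i /= ->.
have UV B : measurable B -> forall A, measurable A ->
    P ((fun t => \sum_(i < n.+1) X i t) @^-1` A `&` X n.+1 @^-1` B `&` E) =
    (P E * (\int[mu]_(x in A) (erlang_pdf l (m.+1 * n.+1).-1 x)%:E *
            \int[mu]_(x in B) (erlang_pdf l m x)%:E))%E.
  move=> mB A' mA'; rewrite -setIA IH//; last 2 first.
  - exact: mXn.
  - move=> C mC; pose C' i := if (i < n.+1)%N then C i else B.
    have Cn : C' n.+1 = B by rewrite /C' ltnn.
    have := HE C'; rewrite bigcapS big_ord_recr/= Cn => H.
    rewrite PE// -muleA [(\int[_]_(x in _) _ * _)%E]muleC.
    rewrite setIA -[X in X `&` _ `&` _](_ : \bigcap_(i in `I_n.+1) (X i @^-1` C' i) = _).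
      rewrite H//; last by move=> i; rewrite /C'; case: ifP.
      congr (_ * (_ * _))%E; apply: eq_bigr => i _.
      by rewrite /C' ltn_ord.
    by apply: eq_bigcapr => i /= ni; rewrite /C' ni.
  by rewrite PE// -muleA; congr (_ * _)%E; exact: muleC.
(* Shapes add; the index is put in the form that [erlang_pdf_convolution] produces. *)
have -> : (m.+1 * n.+2).-1 = ((m.+1 * n.+1).-1 + m).+1.
  by rewrite -addSn prednK ?muln_gt0// (mulnS _ n.+1) addSn/= addnC.
rewrite [X in X @^-1` _](_ : _ = (fun t => \sum_(i < n.+1) X i t) \+ X n.+1); last first.
  by apply/funext => t; rewrite big_ord_recr.
apply: (@independent_sum_law _ _ _ P E _ _ _ _ _
  (erlang_pdf l (m.+1 * n.+1).-1) (erlang_pdf l m)); last exact: mA.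
- exact: mE.
- exact: measurable_sum.
- exact: mX.
- exact: measurable_erlang_pdf.
- exact: measurable_erlang_pdf.
- by move=> x; exact: erlang_pdf_ge0.
- by move=> x; exact: erlang_pdf_ge0.
- by move=> *; exact: UV.
- exact: measurable_erlang_pdf.
- by move=> x; exact: erlang_pdf_ge0.
- by move=> w; exact: erlang_pdf_convolution.
Qed.

End erlang_sum.

(** * The mean of a logarithm as an integral of the tail *)

Section tail_formula.
Context (d : measure_display) (T : measurableType d) (R : realType).
Variable P : probability T R.
Local Notation mu := (@lebesgue_measure R).

Let lam : {sigma_finite_measure set (measurableTypeR R) -> \bar R} := mu.

Lemma integral_ln1D_itv (r y : R) : 0 < r -> 0 <= y ->
  (\int[mu]_(x in `]0%R, y[) (r / (1 + r * x))%:E = (ln (1 + r * y))%:E)%E.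
Proof.
move=> r0; rewrite le_eqVlt => /predU1P[<-|y0].
  by rewrite set_itvoo0 integral_set0 mulr0 addr0 ln1.
have pos x : 0 <= x -> 0 < 1 + r * x.
  by move=> x0; rewrite ltr_pwDl// mulr_ge0// ltW.
have cf x : 0 <= x -> {for x, continuous (fun x => r / (1 + r * x))}.
  move=> /pos/lt0r_neq0 d0; apply: derivable1_continuous; exact: ex_derive.
rewrite -(@integral_itv_bndoo _ _ _ _ true false); last first.
  apply/measurable_EFinP; apply: (@measurable_funS _ _ _ _ `[0, y]%classic) => //.
    exact: subset_itv_oo_cc.
  apply: subspace_continuous_measurable_fun => //.
  by apply: within_continuous => x; rewrite /= in_itv/= => /andP[+ _]; exact: cf.
have -> : ln (1 + r * y) = ln (1 + r * y) - ln (1 + r * 0).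
  by rewrite mulr0 addr0 ln1 subr0.
apply: (@integral_antiderivative _ _ (fun x => ln (1 + r * x))) => //.
- by move=> x /andP[+ _]; exact: cf.
- move=> x /andP[/pos x0 _].
  have dln : is_derive (1 + r * x) 1 (@ln R) (1 + r * x)^-1 by exact: is_derive1_ln.
  apply: is_derive_eq.
  by rewrite /GRing.scale/= ?add0r ?mul1r mulr1 mulrC.
Qed.

(** [ln (1 + r Y)] is the integral of its derivative over [0 < x < Y]; Tonelli exchanges this
    integral with the expectation, both sides being possibly infinite. *)
Lemma expectation_ln1D (r : R) (Y : T -> R) : 0 < r ->
  measurable_fun setT Y -> (forall t, 0 <= Y t) ->
  (\int[P]_t (ln (1 + r * Y t))%:E =
   \int[mu]_(x in `]0%R, +oo[) ((r / (1 + r * x))%:E * P (Y @^-1` `]x, +oo[)))%E.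
Proof.
move=> r0 mY Y0.
(* The absolute value makes [g] continuous on the whole line. *)
pose g (x : R) : R := r / (1 + r * `|x|).
have g0 x : 0 <= g x.
  by rewrite divr_ge0 ?ltW// ltr_pwDl// mulr_ge0// ltW.
have gE x : 0 < x -> g x = r / (1 + r * x) by move=> x0; rewrite /g gtr0_norm.
have mg : measurable_fun setT g.
  apply: continuous_measurable_fun => x; apply: cvgM; first exact: cvg_cst.
  apply: cvgV; first by rewrite gt_eqF// ltr_pwDl// mulr_ge0// ltW.
  apply: cvgD; first exact: cvg_cst.
  by apply: cvgM; [exact: cvg_cst|exact: norm_continuous].
pose phi (z : T * measurableTypeR R) : \bar R :=
  (\1_[set z | 0 < z.2 < Y z.1] z * g z.2)%:E.
have phi0 z : (0 <= phi z)%E by rewrite lee_fin mulr_ge0.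
have mphi : measurable_fun setT phi.
  apply/measurable_EFinP/measurable_funM.
  - apply: measurable_indic.
    rewrite [X in measurable X](_ : _ =
        (fun z : T * measurableTypeR R => 0 < z.2) @^-1` [set true] `&`
        (fun z : T * measurableTypeR R => z.2 < Y z.1) @^-1` [set true]); last first.
      by apply/seteqP; split => z /=; [move/andP=> []|move=> [-> ->]].
    apply: measurableI; rewrite -[X in measurable X]setTI.
      by apply: (measurable_fun_ltr (measurable_cst _) measurable_snd).
    apply: (measurable_fun_ltr measurable_snd) => //.
    exact: measurableT_comp.
  - exact: measurableT_comp.
transitivity (\int[P]_t \int[lam]_x phi (t, x))%E.
  apply: eq_integral => t _; rewrite -integral_ln1D_itv// [LHS]integral_mkcond.
  apply: eq_integral => x _; rewrite patchE /phi indicE/=.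
  rewrite [in RHS](_ : _ \in _ = (x \in `]0%R, (Y t)[)); last first.
    by rewrite in_itv/=; apply/idP/idP => [/set_mem//|?]; exact/mem_set.
  rewrite mem_setE; case: ifPn => [|_]; last by rewrite mul0r.
  by rewrite in_itv/= => /andP[x0 _]; rewrite mul1r gE.
rewrite (fubini_tonelli phi)// [RHS]integral_mkcond; apply: eq_integral => x _.
rewrite patchE mem_setE in_itv/= andbT; case: ifPn => x0; last first.
  apply: integral0_eq => t _; rewrite /phi indicE memNset ?mul0r//=.
  by rewrite (negbTE x0).
have mYx : measurable (Y @^-1` `]x, +oo[).
  by rewrite -[X in measurable X]setTI; exact: mY.
have d0 : 0 <= r / (1 + r * x).
  by rewrite divr_ge0 ?ltW// ltr_pwDl// mulr_ge0// ltW.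
transitivity (\int[P]_t ((r / (1 + r * x))%:E * (\1_(Y @^-1` `]x, +oo[) t)%:E))%E.
  apply: eq_integral => t _; rewrite /phi /= mulrC EFinM gE//; congr (_ * _%:E)%E.
  rewrite !indicE; congr (_%:R).
  apply: (congr1 nat_of_bool); apply/idP/idP => /set_mem/= H; apply/mem_set => /=.
    by move: H; rewrite x0 in_itv/= andbT.
  by move: H; rewrite x0 in_itv/= andbT.
rewrite ge0_integralZl//.
- by rewrite integral_indic// setIT.
- by apply/measurable_EFinP; exact: measurable_indic.
Qed.

End tail_formula.

(** * Joint law of the two combined gains and the integral of their tails *)

Section min_of_sums.
Context (d : measure_display) (T : measurableType d) (R : realType).
Variable P : probability T R.
Local Notation mu := (@lebesgue_measure R).

Lemma erlang_sum_law_ord (l : R) m n (G : 'I_n.+1 -> T -> R) (E : set T) :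
  0 < l -> measurable E -> (forall i, measurable_fun setT (G i)) ->
  (forall B : 'I_n.+1 -> set R, (forall i, measurable (B i)) ->
    P (\bigcap_(i in setT) (G i @^-1` B i) `&` E) =
    (P E * \prod_(i < n.+1) \int[mu]_(x in B i) (erlang_pdf l m x)%:E)%E) ->
  forall A, measurable A ->
    P ((fun t => \sum_(i < n.+1) G i t) @^-1` A `&` E) =
    (P E * \int[mu]_(x in A) (erlang_pdf l (m.+1 * n.+1).-1 x)%:E)%E.
Proof.
move=> l0 mE mG HE A mA.
(* [inord] extends the finite family to all natural indices, keeping those below [n.+1]. *)
rewrite -(@erlang_sum_law _ _ _ P l m n (fun i => G (inord i)))//.
- rewrite [X in P (X @^-1` _ `&` _)](_ : _ = fun t => \sum_(i < n.+1) G (inord i) t)//.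
  by apply/funext => t; apply: eq_bigr => i _; rewrite inord_val.
- move=> B mB; have := HE (fun i => B i) (fun i => mB i) => <-.
  congr (P (_ `&` _)); apply/seteqP; split => t H i /=.
    by move=> _; have := H i; rewrite /= inord_val; apply.
  by move=> ni; have := H (inord i) Logic.I; rewrite /= inordK.
Qed.

(** Apply independence to the full index set, with the whole line as the condition on each [Z k], an
    event of probability one. *)
Lemma mutually_independent_sumlr (I J K : finType) (X : I -> T -> R) (Y : J -> T -> R)
    (Z : K -> T -> R) (A : I -> set R) (B : J -> set R) :
  mutually_independent P (fun k : I + (J + K) =>
    match k with inl i => X i | inr (inl j) => Y j | inr (inr j) => Z j end) ->
  (forall i, measurable (A i)) -> (forall j, measurable (B j)) ->
  P (\bigcap_(i in setT) (X i @^-1` A i) `&` \bigcap_(j in setT) (Y j @^-1` B j)) =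
  (\prod_i P (X i @^-1` A i) * \prod_j P (Y j @^-1` B j))%E.
Proof.
move=> ind mA mB.
pose C (k : I + (J + K)) : set R :=
  match k with inl i => A i | inr (inl j) => B j | inr (inr j) => setT end.
have := ind [set: I + (J + K)]%SET C.
rewrite !big_sumType/= [X in (_ * (_ * X))%E]big1; last first.
  by move=> k _; rewrite preimage_setT probability_setT.
rewrite mule1 => H.
transitivity ((\prod_(i in [set: I]%SET) P (X i @^-1` A i) *
   \prod_(i in [set: J]%SET) P (Y i @^-1` B i)))%E; last first.
  by congr (_ * _)%E; apply: eq_bigl => i; rewrite inE.
etransitivity; last (etransitivity; first apply: H).
- congr (P _); apply/seteqP; split => t.
    by move=> [HA HB] [i|[j|k]] _ //=; [exact: HA|exact: HB].
  move=> H'; split=> i _.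
    by apply: (H' (inl i)); rewrite /= inE.
  by apply: (H' (inr (inl i))); rewrite /= inE.
- by move=> [i|[j|k]] /=.
- by congr (_ * _)%E; apply: eq_bigl => i; rewrite !inE.
Qed.

Lemma gamma_pdfE m (Om : R) : gamma_pdf m.+1 Om = erlang_pdf (m.+1%:R / Om) m.
Proof.
apply/funext => x; rewrite /gamma_pdf /erlang_pdf; case: ifP => // _.
by rewrite /= (mulrAC _ Om^-1 x).
Qed.

(** [erlang_sum_law_ord] is used twice: first for the [X i], with [E] an event on the [Y j]; then
    for the [Y j], with [E] the event that the sum of the [X i] lies in [A]. *)
Lemma independent_erlang_sums (K : finType) m1 n1 m2 n2 (l1 l2 : R)
    (X : 'I_n1.+1 -> T -> R) (Y : 'I_n2.+1 -> T -> R) (Z : K -> T -> R) :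
  0 < l1 -> 0 < l2 ->
  mutually_independent P (fun k : 'I_n1.+1 + ('I_n2.+1 + K) =>
    match k with inl i => X i | inr (inl j) => Y j | inr (inr j) => Z j end) ->
  (forall i, has_density P (X i) (erlang_pdf l1 m1)) ->
  (forall i, has_density P (Y i) (erlang_pdf l2 m2)) ->
  forall A B, measurable A -> measurable B ->
  P ((fun t => \sum_i X i t) @^-1` A `&` (fun t => \sum_j Y j t) @^-1` B) =
  (\int[mu]_(x in A) (erlang_pdf l1 (m1.+1 * n1.+1).-1 x)%:E *
   \int[mu]_(x in B) (erlang_pdf l2 (m2.+1 * n2.+1).-1 x)%:E)%E.
Proof.
move=> l10 l20 ind dX dY A B mA mB.
have mX i : measurable_fun setT (X i) by case: (dX i).
have mY i : measurable_fun setT (Y i) by case: (dY i).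
have joint (C : 'I_n1.+1 -> set R) (D : 'I_n2.+1 -> set R) :
    (forall i, measurable (C i)) -> (forall i, measurable (D i)) ->
    P (\bigcap_(i in setT) (X i @^-1` C i) `&` \bigcap_(j in setT) (Y j @^-1` D j)) =
    (\prod_i \int[mu]_(x in C i) (erlang_pdf l1 m1 x)%:E *
     \prod_j \int[mu]_(x in D j) (erlang_pdf l2 m2 x)%:E)%E.
  move=> mC mD; rewrite (mutually_independent_sumlr _ _ _ _ _ _ _ _ ind)//.
  congr (_ * _)%E; apply: eq_bigr => i _.
    by case: (dX i) => _; exact.
  by case: (dY i) => _; exact.
have capT (n : nat) (F : 'I_n -> T -> R) : \bigcap_(i in setT) (F i @^-1` setT) = setT.
  by apply/seteqP; split.
have jointY (D : 'I_n2.+1 -> set R) : (forall i, measurable (D i)) ->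
    P (\bigcap_(j in setT) (Y j @^-1` D j)) =
    (\prod_j \int[mu]_(x in D j) (erlang_pdf l2 m2 x)%:E)%E.
  move=> mD; have := joint (fun=> setT) D; rewrite capT setTI => ->//.
  by rewrite big1 ?mul1e// => i _; exact: integral_erlang_pdf.
have mcapY (D : 'I_n2.+1 -> set R) : (forall i, measurable (D i)) ->
    measurable (\bigcap_(j in setT) (Y j @^-1` D j)).
  move=> mD; apply: fin_bigcap_measurable => //.
  by move=> i _; rewrite -[X in measurable X]setTI; exact: mY.
have sumX (D : 'I_n2.+1 -> set R) : (forall i, measurable (D i)) ->
    P ((fun t => \sum_i X i t) @^-1` A `&` \bigcap_(j in setT) (Y j @^-1` D j)) =
    (P (\bigcap_(j in setT) (Y j @^-1` D j)) *
     \int[mu]_(x in A) (erlang_pdf l1 (m1.+1 * n1.+1).-1 x)%:E)%E.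
  move=> mD; apply: erlang_sum_law_ord => //; first exact: mcapY.
  by move=> C mC; rewrite joint// jointY// muleC.
have PA : P ((fun t => \sum_i X i t) @^-1` A) =
    (\int[mu]_(x in A) (erlang_pdf l1 (m1.+1 * n1.+1).-1 x)%:E)%E.
  by have := sumX (fun=> setT); rewrite capT setIT probability_setT mul1e => ->.
rewrite setIC -PA; apply: erlang_sum_law_ord => //.
  rewrite -[X in measurable X]setTI; apply: measurable_sum => //.
by move=> D mD; rewrite setIC sumX// jointY// PA muleC.
Qed.

(** Expanding both tails merges the exponentials into one of rate [l1 + l2]; the coefficients are
    nonnegative, so integration is termwise, and [integral_exprM_expR_div] at [n = i + j] evaluates
    each term. *)
Lemma integral_erlang_tailM (l1 l2 r : R) M N : 0 < l1 -> 0 < l2 -> 0 < r ->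
  (\int[mu]_(x in `]0%R, +oo[)
    ((r / (1 + r * x))%:E * (erlang_tail l1 M x * erlang_tail l2 N x)%:E) =
  (\sum_(i < M) \sum_(j < N) l1 ^+ i * l2 ^+ j * (i + j)`!%:R /
     (i`!%:R * j`!%:R * r ^+ (i + j)) *
     (expR ((l1 + l2) / r) * upper_inc_gamma (- (i + j)%:R) ((l1 + l2) / r)))%:E)%E.
Proof.
move=> l10 l20 r0; rewrite pair_bigA/=.
pose c (p : 'I_M * 'I_N) : R := l1 ^+ p.1 / p.1`!%:R * (l2 ^+ p.2 / p.2`!%:R).
pose k n (x : R) := x ^+ n * expR (- ((l1 + l2) * x)) * (r / (1 + r * x)).
have c0 p : 0 <= c p by rewrite mulr_ge0// divr_ge0// exprn_ge0// ltW.
have mk n : measurable_fun `]0 : R, +oo[%classic (k n).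
  apply: (@measurable_funS _ _ _ _ `[0 : R, +oo[%classic) => //.
    by apply: subset_itvr; rewrite bnd_simp.
  exact: measurable_exprM_expR_div.
have k0 n x : 0 < x -> 0 <= k n x.
  move=> x0; rewrite mulr_ge0//; last first.
    by rewrite divr_ge0 ?ltW// ltr_pwDl// mulr_ge0// ltW.
  by rewrite mulr_ge0 ?expR_ge0// exprn_ge0// ltW.
transitivity (\int[mu]_(x in `]0%R, +oo[) (\sum_p ((c p)%:E * (k (p.1 + p.2)%N x)%:E)))%E.
  apply: eq_integral => x _; rewrite -EFinM.
  under [in RHS]eq_bigr do rewrite -EFinM.
  rewrite sumEFin; congr EFin.
  rewrite /erlang_tail [X in _ * X]mulrACA big_distrlr/= pair_bigA/= mulrA mulr_sumr.
  apply: eq_bigr => p _; rewrite /c /k mulrDl opprD expRD exprD !exprMn.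
  ring.
rewrite ge0_integral_sum//; last 2 first.
- move=> p; apply/measurable_EFinP/measurable_funM => //; exact: mk.
- move=> p x; rewrite /= in_itv/= andbT => x0.
  by rewrite mule_ge0// lee_fin// k0.
rewrite -sumEFin; apply: eq_bigr => p _.
rewrite ge0_integralZl//; last 3 first.
- by apply/measurable_EFinP; exact: mk.
- by move=> x; rewrite /= in_itv/= andbT => x0; rewrite lee_fin k0.
- by rewrite lee_fin.
rewrite integral_itvoy_cy; last exact: mk.
rewrite integral_exprM_expR_div ?addr_gt0// -EFinM; congr EFin.
have f0 n : n`!%:R != 0 :> R by rewrite pnatr_eq0 -lt0n fact_gt0.
rewrite /c; field.
by rewrite !f0 expf_neq0// gt_eqF.
Qed.

End min_of_sums.

(** * The average rate of the first symbol *)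

Theorem theorem2 (R : realType) (d : measure_display) (T : measurableType d)
  (P : probability T R)
  (Nr Nd msr msd : nat) (Osr Osd Ord : R) (mrd : nat)
  (rho a1 a2 : R)
  (Gsr : 'I_Nr -> T -> R) (Gsd Grd : 'I_Nd -> T -> R) :
  (0 < Nr)%N -> (0 < Nd)%N -> (0 < msr)%N -> (0 < msd)%N -> (0 < mrd)%N ->
  0 < Osr -> 0 < Osd -> 0 < Ord -> 0 < rho ->
  0 < a1 < 1 -> 0 < a2 < 1 -> a1 + a2 = 1 -> a2 < a1 ->
  mutually_independent P
    (fun k : 'I_Nr + ('I_Nd + 'I_Nd) =>
       match k with inl i => Gsr i | inr (inl j) => Gsd j | inr (inr j) => Grd j end) ->
  (forall i, has_density P (Gsr i) (gamma_pdf msr Osr)) ->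
  (forall j, has_density P (Gsd j) (gamma_pdf msd Osd)) ->
  (forall k, has_density P (Grd k) (gamma_pdf mrd Ord)) ->
  let gsr := fun t => \sum_(i < Nr) Gsr i t in
  let gsd := fun t => \sum_(j < Nd) Gsd j t in
  let X := fun t => Order.min (gsr t) (gsd t) in
  let Phi := msr%:R / Osr + msd%:R / Osd in
  (2^-1%:E * \int[P]_(t in setT)
      (log2 (1 + rho * X t) - log2 (1 + a2 * rho * X t))%:E)%E =
  ((2 * ln 2)^-1 *
   \sum_(mu < msr * Nr) \sum_(nu < msd * Nd)
     (msr%:R ^+ mu * msd%:R ^+ nu * (mu + nu)`!%:R /
      (Osr ^+ mu * Osd ^+ nu * mu`!%:R * nu`!%:R * rho ^+ (mu + nu)) *
      (expR (Phi / rho) * upper_inc_gamma (- (mu + nu)%:R) (Phi / rho) -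
       (a2 ^+ (mu + nu))^-1 * expR (Phi / (rho * a2)) *
         upper_inc_gamma (- (mu + nu)%:R) (Phi / (rho * a2)))))%:E.
Proof.
move=> Nr0 Nd0 msr0 msd0 _ Osr0 Osd0 _ rho0 _ /andP[a20 _] _ _.
case: Nr Gsr Nr0 => [//|nr] Gsr _; case: Nd Gsd Grd Nd0 => [//|nd] Gsd Grd _.
case: msr msr0 => [//|mr] _; case: msd msd0 => [//|md] _.
move=> ind dsr dsd _ gsr gsd X Phi.
pose l1 : R := mr.+1%:R / Osr; pose l2 : R := md.+1%:R / Osd.
have l10 : 0 < l1 by rewrite divr_gt0.
have l20 : 0 < l2 by rewrite divr_gt0.
rewrite gamma_pdfE in dsr; rewrite gamma_pdfE in dsd.
have mgsr : measurable_fun setT gsr.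
  by apply: measurable_sum => i; case: (dsr i).
have mgsd : measurable_fun setT gsd.
  by apply: measurable_sum => i; case: (dsd i).
have mX : measurable_fun setT X by exact: measurable_minr.
have mXitv (i : interval R) : measurable (X @^-1` [set` i]).
  by rewrite -[X in measurable X]setTI; exact: mX.
pose M := (mr.+1 * nr.+1)%N; pose N := (md.+1 * nd.+1)%N.
have tailX x : 0 <= x ->
    P (X @^-1` `]x, +oo[) = (erlang_tail l1 M x * erlang_tail l2 N x)%:E.
  move=> x0; rewrite EFinM.
  (* [M] and [N] are positive, so density index [M.-1] corresponds to a tail of [M] terms, and
     likewise for [N]. *)
  have := integral_erlang_pdf_itv l1 M.-1 x l10 x0 => <-.
  have := integral_erlang_pdf_itv l2 N.-1 x l20 x0 => <-.
  rewrite -(independent_erlang_sums _ _ _ P _ _ _ _ _ _ _ _ _ _ l10 l20 ind dsr dsd)//.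
  congr (P _); apply/seteqP; split => t /=; rewrite !in_itv/= !andbT lt_min.
    by move=> /andP.
  by move=> [-> ->].
(* The positive part of [X] meets the nonnegativity hypothesis of [expectation_ln1D] and agrees with
   [X] almost surely. *)
pose L r t : R := ln (1 + r * Order.max (X t) 0).
pose C r : R := \sum_(i < M) \sum_(j < N) l1 ^+ i * l2 ^+ j * (i + j)`!%:R /
     (i`!%:R * j`!%:R * r ^+ (i + j)) *
     (expR ((l1 + l2) / r) * upper_inc_gamma (- (i + j)%:R) ((l1 + l2) / r)).
have mXp : measurable_fun setT (fun t => Order.max (X t) 0).
  exact: measurable_maxr.
have mln (r : R) (Y : T -> R) : measurable_fun setT Y ->
    measurable_fun setT (fun t => ln (1 + r * Y t)).
  move=> mY; apply: (measurableT_comp (@measurable_ln R)).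
  by apply: measurable_funD => //; exact: measurable_funM.
have mL r : measurable_fun setT (L r) by exact: mln.
have EL r : 0 < r -> (\int[P]_t (L r t)%:E = (C r)%:E)%E.
  move=> r0; rewrite expectation_ln1D//; last by move=> t; rewrite le_max lexx orbT.
  rewrite -integral_erlang_tailM//; apply: eq_integral => x.
  rewrite inE/= in_itv/= andbT => x0; rewrite -tailX ?ltW//; congr (_ * P _)%E.
  (* For [x > 0], the positive part exceeds [x] exactly when [X] does. *)
  by apply/seteqP; split => t /=; rewrite !in_itv/= !andbT lt_max (lt_gtF x0) orbF.
have L0 r t : 0 < r -> 0 <= L r t.
  move=> r0; apply: ln_ge0; rewrite lerDl mulr_ge0//; first exact: ltW.
  by rewrite le_max lexx orbT.
have iL r : 0 < r -> P.-integrable setT (EFin \o L r).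
  move=> r0; apply/integrableP; split; first exact/measurable_EFinP.
  under eq_integral do rewrite /= ger0_norm ?L0//.
  by rewrite EL// ltry.
(* The complementary event is the tail at zero, where both Erlang tails equal one. *)
have X0 : P (X @^-1` `]-oo, 0]) = 0%E.
  rewrite (_ : X @^-1` `]-oo, 0] = ~` (X @^-1` `]0, +oo[)).
    by rewrite probability_setC// tailX// !erlang_tail0 mulr1 subee.
  by apply/seteqP; split => t /=; rewrite !in_itv/= andbT leNgt => /negP.
have ar0 : 0 < a2 * rho by rewrite mulr_gt0.
(* Off the null event [X <= 0] the positive part is [X] itself; integrability of each [L r] then
   allows the difference to be split. *)
rewrite (@ae_eq_integral _ _ _ P setT
   (fun t => (ln 2)^-1%:E * ((L rho t)%:E - (L (a2 * rho) t)%:E)))%E//; last 3 first.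
- apply/measurable_EFinP/measurable_funB; apply: measurable_funM => //; exact: mln.
- apply/measurable_EFinP/measurable_funM => //; exact: measurable_funB.
- exists (X @^-1` `]-oo, 0]); split => // t /= H.
  rewrite in_itv/= leNgt; apply/negP => Xt; apply: H => _.
  rewrite /L /log2 max_l ?ltW// -EFinB -EFinM; congr EFin; ring.
rewrite integralZl//; last by apply: integrableB => //; exact: iL.
rewrite integralB_EFin//; [|exact: iL..].
rewrite !EL// -EFinB -!EFinM; congr EFin.
rewrite /C -sumrB mulrA -invfM; congr (_ * _); apply: eq_bigr => i _.
rewrite -sumrB; apply: eq_bigr => j _.
rewrite (mulrC a2 rho) -/Phi.
have f0 n : n`!%:R != 0 :> R by rewrite pnatr_eq0 -lt0n fact_gt0.
(* Splitting [(rho * a2) ^+ (i + j)] releases the factor [a2^-(i+j)] of the second term. *)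
rewrite /l1 /l2 !exprMn !exprVn; field.
rewrite !f0 !expf_neq0 ?gt_eqF//.
Qed.
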